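(* Let $0<q<1$, let $a,b,c,d,r,\lambda$ be complex numbers with $\max\{|a|,|b|,|c|,|d|,|r|\}<1$, and put $\alpha=a^2bcdr/q$. Then \begin{align*} &\sum_{n=0}^\infty \frac{( \sqrt{\lambda}, -\sqrt{\lambda}, ab, ac, ad, ar; q)_n (bcdr)^n}{(q, \sqrt{q\alpha}, -\sqrt{q\alpha}, \lambda, abcd, abcr; q)_n}\, {}_3\phi_2\left({{abq^n, acq^n, bc}\atop{abcdq^n, abcrq^n}}; q, dr\right)\\ &=\frac{(abdr, acdr; q)_\infty}{( dr, q\alpha; q)_\infty} \sum_{n=0}^\infty \frac{(1-\alpha q^{4n})(\alpha, ab, ac, ad, ar; q)_{2n} (q, q\alpha/\lambda; q^2)_n}{(1-\alpha)(q, abcd, abcr, abdr, acdr; q)_{2n} (q\alpha, q \lambda; q^2)_n} (bcdr)^{2n} \lambda^n q^{2n^2-n}. \end{align*}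
   Context: For $0<q<1$ and base $p\in\{q,q^2\}$: $(a;p)_n=\prod_{k=0}^{n-1}(1-ap^k)$, $(a;p)_\infty=\prod_{k\ge0}(1-ap^k)$, $(a_1,\dots,a_m;p)_n=(a_1;p)_n\cdots(a_m;p)_n$. ${}_{3}\phi_2\left({{a_1,a_2,a_3}\atop{b_1,b_2}};q,z\right)=\sum_{n\ge0}\frac{(a_1,a_2,a_3;q)_n}{(q,b_1,b_2;q)_n}z^n$; $\sqrt{\lambda}$ and $\sqrt{q\alpha}$ denote fixed square roots. *)

(* Defs.v *)
From Stdlib Require Export Reals List.
From Coquelicot Require Export Coquelicot.
Export ListNotations.

Open Scope C_scope.

(* Coquelicot's [Lim_seq] and [Series] are real-valued only.  The two operators
   below are total and return the true value when the limit exists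
   ([CLim_correct], [CSeries_correct]); convergence is asserted separately. *)
Definition CLim (u : nat -> C) : C :=
  (real (Lim_seq (fun n => Re (u n))), real (Lim_seq (fun n => Im (u n)))).

Definition CSeries (u : nat -> C) : C := CLim (sum_n u).

Definition ex_Cseries (u : nat -> C) : Prop :=
  @ex_series C_AbsRing C_NormedModule u.

Lemma CLim_correct (u : nat -> C) (l : C) :
  filterlim u eventually (locally l) -> CLim u = l.
Proof.
  intros H.
  assert (H1 : is_lim_seq (fun n => Re (u n)) (Re l)).
  { intros P [e He].
    apply (H (fun z => P (Re z))).
    exists e; intros z [Hz _]; apply He; exact Hz. }
  assert (H2 : is_lim_seq (fun n => Im (u n)) (Im l)).
  { intros P [e He].
    apply (H (fun z => P (Im z))).
    exists e; intros z [_ Hz]; apply He; exact Hz. }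
  unfold CLim.
  rewrite (is_lim_seq_unique _ _ H1), (is_lim_seq_unique _ _ H2).
  now destruct l.
Qed.

Lemma CSeries_correct (u : nat -> C) (l : C) :
  @is_series C_AbsRing C_NormedModule u l -> CSeries u = l.
Proof. exact (CLim_correct (sum_n u) l). Qed.

Fixpoint qpoch (a p : C) (n : nat) : C :=
  match n with
  | O => 1
  | S m => qpoch a p m * (1 - a * p ^ m)
  end.

Definition qpoch_inf (a p : C) : C := CLim (qpoch a p).

Definition qpochs (l : list C) (p : C) (n : nat) : C :=
  fold_right (fun a x => qpoch a p n * x) 1 l.

Definition qpochs_inf (l : list C) (p : C) : C :=
  fold_right (fun a x => qpoch_inf a p * x) 1 l.

Definition phi32_term (a1 a2 a3 b1 b2 q z : C) (n : nat) : C :=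
  qpochs [a1; a2; a3] q n / qpochs [q; b1; b2] q n * z ^ n.

Definition phi32 (a1 a2 a3 b1 b2 q z : C) : C :=
  CSeries (phi32_term a1 a2 a3 b1 b2 q z).

(* Main.v *)
Require Import Defs.
From Stdlib Require Import Lia Lra.

(** Put [e = q alpha].  The left-hand side is the sum over [M] of
    [(ab, ac; q)_M (dr)^M beta'_M], where [beta'] arises from
    [w_n = (lambda; q^2)_n / ((q, lambda; q)_n (e; q^2)_n)] by one step of the Bailey
    chain with parameters [ad], [ar].  A terminating very-well-poised 6-phi-5
    sum in base [q^2], proved by telescoping, shows that [w] is the beta-side of a
    Bailey pair whose alpha-side lives on even indices; applying the Bailey lemma
    once more, in its infinite form with parameters [ab], [ac], gives the
    right-hand side.  The finite Bailey lemma is the q-Pfaff-Saalschuetz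
    sum; the infinite one is the q-Gauss sum, its limit. *)

(** The two Bailey steps can follow each other because e = a^2 bcdr factors both as (ad)(ar)(bc) and
    as (ab)(ac)(dr), so the pair stays relative to the same e. The inner 3-phi-2 comes from the
    summation inside the first step: with n + m = M the symbols (ab;q)_n (ab q^n;q)_m merge into
    (ab;q)_M, likewise for ac, abcd and abcr, and the remaining factors depend on n alone or on m
    alone. The Bailey statements are parametrized by [t] with e = XYt, and use [X * t] and [Y * t]
    where e/Y and e/X are customary, so that nothing is divided by a parameter that may vanish. On
    the analytic side [lam] may have any modulus; only the quadratic exponent of q makes the
    alpha-side summable. The exchanges of infinite sums all rest on one dominated convergence
    lemma. *)

(* [sum_n] typed in [C] rather than in an abstract carrier, so that [ring] and
   [field] recognize the operations. *)
Definition csum (u : nat -> C) (n : nat) : C := sum_n u n.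

Lemma csum_O (u : nat -> C) : csum u 0 = u 0%nat.
Proof. exact (sum_O u). Qed.

Lemma csum_S (u : nat -> C) n : csum u (S n) = csum u n + u (S n).
Proof. exact (sum_Sn u n). Qed.

Lemma csum_ext (u v : nat -> C) n :
  (forall k, (k <= n)%nat -> u k = v k) -> csum u n = csum v n.
Proof. exact (sum_n_ext_loc u v n). Qed.

Lemma csum_plus (u v : nat -> C) n :
  csum (fun k => u k + v k) n = csum u n + csum v n.
Proof. exact (sum_n_plus u v n). Qed.

Lemma csum_mult_l (x : C) (u : nat -> C) n :
  csum (fun k => x * u k) n = x * csum u n.
Proof. exact (sum_n_mult_l (K := C_Ring) x u n). Qed.

(** Passing from N to N + 1 adds one antidiagonal: each inner sum gains one term and a new one
    starts. It serves the finite exchange in [bailey_finite] and, in the limit,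
    [series_triangle]. *)
Lemma csum_triangle (g : nat -> nat -> C) N :
  csum (fun M => csum (fun n => g n (M - n)%nat) M) N =
  csum (fun n => csum (g n) (N - n)) N.
Proof.
  induction N as [|N IH].
  - reflexivity.
  - rewrite csum_S, IH, !csum_S; cbv beta. rewrite Nat.sub_diag, csum_O, Cplus_assoc.
    f_equal. rewrite <- csum_plus. apply csum_ext. intros k Hk.
    replace (S N - k)%nat with (S (N - k)) by lia.
    now rewrite csum_S.
Qed.

(** The odd upper end 2N + 1 groups the indices in pairs 2j, 2j + 1, so each induction step adds one
    even and one odd index. *)
Lemma csum_even (f : nat -> C) N :
  csum (fun J => if Nat.even J then f (Nat.div2 J) else 0) (S (2 * N)) =
  csum f N.
Proof.
  induction N as [|N IH].
  - rewrite csum_S, !csum_O. simpl. ring.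
  - replace (S (2 * S N)) with (S (S (S (2 * N)))) by lia.
    rewrite !(csum_S _ (S _)), IH.
    replace (S (S (2 * N))) with (2 * S N)%nat by lia.
    rewrite Nat.even_succ, <- Nat.negb_even, Nat.even_mul, Nat.div2_double.
    rewrite csum_S. simpl. ring.
Qed.

Lemma csum_stationary (u : nat -> C) n m :
  (n <= m)%nat -> (forall k, (n < k)%nat -> u k = 0) -> csum u m = csum u n.
Proof.
  intros Hle Hu. induction Hle as [|m Hle IH]; [reflexivity|].
  rewrite csum_S, IH, Hu by lia. ring.
Qed.

(** * Algebra of q-shifted factorials *)

Lemma qpoch_S a p n : qpoch a p (S n) = qpoch a p n * (1 - a * p ^ n).
Proof. reflexivity. Qed.

Lemma qpoch_add a p m n :
  qpoch a p (m + n) = qpoch a p m * qpoch (a * p ^ m) p n.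
Proof.
  induction n as [|n IH].
  - rewrite Nat.add_0_r. simpl. ring.
  - rewrite Nat.add_succ_r, !qpoch_S, IH, Cpow_add_r. ring.
Qed.

Lemma qpoch_S_l a p n : qpoch a p (S n) = (1 - a) * qpoch (a * p) p n.
Proof.
  change (S n) with (1 + n)%nat. rewrite qpoch_add. simpl.
  now rewrite !Cmult_1_r, Cmult_1_l.
Qed.

Lemma qpoch_nz a p n : (forall k, 1 - a * p ^ k <> 0) -> qpoch a p n <> 0.
Proof.
  intros H. induction n as [|n IH]; simpl.
  - exact C1_nz.
  - now apply Cmult_neq_0.
Qed.

Lemma Cpow_sqr_comm (p : C) n : (p ^ 2) ^ n = (p ^ n) ^ 2.
Proof. now rewrite <- !Cpow_mult_r, Nat.mul_comm. Qed.

Lemma qpoch_double a p n :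
  qpoch a p (2 * n) = qpoch a (p ^ 2) n * qpoch (a * p) (p ^ 2) n.
Proof.
  induction n as [|n IH]; [simpl; ring|].
  replace (2 * S n)%nat with (S (S (2 * n))) by lia.
  rewrite !qpoch_S, IH, (Cpow_S p (2 * n)), Cpow_mult_r. ring.
Qed.

Lemma qpoch_opp_sqrt s p n :
  qpoch s p n * qpoch (- s) p n = qpoch (s ^ 2) (p ^ 2) n.
Proof.
  induction n as [|n IH]; [simpl; ring|].
  rewrite !qpoch_S, <- IH, Cpow_sqr_comm. ring.
Qed.

(* The base-[/q] symbol is [(1 - Q)(1 - Q/q)...]; at [Q = q^n] it is
   [(q;q)_n / (q;q)_(n-k)] when [k <= n] and vanishes when [k > n]. *)
Lemma qpoch_inv_pow (q : C) n k : q <> 0 -> (k <= n)%nat ->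
  qpoch (q ^ n) (/ q) k * qpoch q q (n - k) = qpoch q q n.
Proof.
  intros Hq. induction k as [|k IH]; intros Hk.
  - rewrite Nat.sub_0_r. simpl. ring.
  - rewrite <- IH by lia.
    replace (n - k)%nat with (S (n - S k)) by lia.
    rewrite !qpoch_S.
    replace (q ^ n * (/ q) ^ k) with (q * q ^ (n - S k)); [ring|].
    replace n with (k + S (n - S k))%nat at 2 by lia.
    rewrite Cpow_add_r, Cpow_inv, Cpow_S by assumption.
    field. now apply Cpow_nz.
Qed.

Lemma qpoch_inv_pow_0 (q : C) n k : q <> 0 -> (n < k)%nat ->
  qpoch (q ^ n) (/ q) k = 0.
Proof.
  intros Hq Hk. replace k with (n + S (k - S n))%nat by lia.
  rewrite qpoch_add, qpoch_S_l, Cpow_inv by assumption.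
  replace (1 - q ^ n * / q ^ n) with (0:C); [ring|].
  field. now apply Cpow_nz.
Qed.

(** * The q-Pfaff-Saalschuetz sum and the finite Bailey lemma *)

(* The two sides satisfy the same first-order recurrence in [K]; the defect of the
   partial sums telescopes, and the last product is the WZ antidifference. *)
Lemma saalschutz_partial (q X Y t : C) m : 
  (forall k, 1 - q * q ^ k <> 0) ->
  (forall k, 1 - X * Y * t * q ^ k <> 0) ->
  let s K i := t ^ i * qpoch X q i * qpoch Y q i * qpoch t q (K - i)
               / (qpoch q q (K - i) * qpoch q q i * qpoch (X * Y * t) q i) in
  forall l, 
  let K := (m + l)%nat in
  (1 - q * q ^ K) * (1 - X * Y * t * q ^ K) * csum (s (S K)) m =
  (1 - X * t * q ^ K) * (1 - Y * t * q ^ K) * csum (s K) m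
  - q ^ l * t ^ S m * qpoch X q (S m) * qpoch Y q (S m) * qpoch t q l
    / (qpoch q q l * qpoch q q m * qpoch (X * Y * t) q m).
Proof.
  intros Hq He s.
  assert (Nq : forall k, qpoch q q k <> 0) by (intros; now apply qpoch_nz).
  assert (Ne : forall k, qpoch (X * Y * t) q k <> 0) by (intros; now apply qpoch_nz).
  induction m as [|m IH]; intros l K; unfold K.
  - rewrite !csum_O. unfold s. simpl (0 + l)%nat. rewrite !Nat.sub_0_r, !qpoch_S.
    simpl. field. repeat split; try apply Nq; try apply Hq; exact C1_nz.
  - rewrite !csum_S, !Cmult_plus_distr_l.
    (* The claims for [S m], [l] and for [m], [S l] concern the same K; this is why [l] stays
       quantified in the induction. *)
    specialize (IH (S l)). simpl in IH.
    replace (S m + l)%nat with (m + S l)%nat by lia. 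
    rewrite IH. unfold s.
    replace (S (m + S l) - S m)%nat with (S l) by lia.
    replace (m + S l - S m)%nat with l by lia.
    rewrite Cpow_add_r, !qpoch_S, !Cpow_S.
    generalize (Nq l) (Nq m) (Ne m) (Hq l) (Hq m) (He m).
    generalize (qpoch q q l) (qpoch q q m) (qpoch (X * Y * t) q m).
    intros. field. repeat split; assumption.
Qed.

(** The usual parameters q^(-K) and q^(1-K)/t of the balanced 3-phi-2 are absorbed into the reversed
    symbols (q;q)_(K-i) and (t;q)_(K-i), which needs no negative power of [q] and allows [t] to be
    zero. *)
Lemma saalschutz (q X Y t : C) K :
  (forall k, 1 - q * q ^ k <> 0) ->
  (forall k, 1 - X * Y * t * q ^ k <> 0) ->
  csum (fun i => t ^ i * qpoch X q i * qpoch Y q i * qpoch t q (K - i)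
               / (qpoch q q (K - i) * qpoch q q i * qpoch (X * Y * t) q i)) K
  = qpoch (X * t) q K * qpoch (Y * t) q K
    / (qpoch q q K * qpoch (X * Y * t) q K).
Proof.
  intros Hq He.
  assert (Nq : forall k, qpoch q q k <> 0) by (intros; now apply qpoch_nz).
  assert (Ne : forall k, qpoch (X * Y * t) q k <> 0) by (intros; now apply qpoch_nz).
  induction K as [|K IH].
  - rewrite csum_O. simpl. field.
  - rewrite csum_S, Nat.sub_diag.
    (* At [l = 0] the partial identity covers the whole sum for [S K] except its last term, which
       [csum_S] has just split off. *)
    pose proof (saalschutz_partial q X Y t K Hq He 0) as P. cbv zeta in P.
    rewrite Nat.add_0_r, IH in P.
    match type of P with _ * ?Z = _ => set (Sig := Z) in * end.
    assert (E : Sig = ((1 - q * q ^ K) * (1 - X * Y * t * q ^ K) * Sig)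
      / ((1 - q * q ^ K) * (1 - X * Y * t * q ^ K))).
    { field. split; [apply He | apply Hq]. }
    rewrite E, P. clear P E. rewrite !qpoch_S, !Cpow_S. simpl (qpoch _ _ 0). simpl (_ ^ 0).
    field. repeat split; try apply Nq; try apply Ne; try apply He; try apply Hq; exact C1_nz.
Qed.

(** For e = q alpha this is a Bailey pair relative to alpha in the usual sense. *)
Definition bailey_pair (q e : C) (al be : nat -> C) : Prop :=
  forall n, be n =
    csum (fun J => al J / (qpoch q q (n - J) * qpoch e q (n + J))) n.

(** After inserting the definition of [be] and writing n = J + i, the sum over i is a Saalschuetz
    sum with X q^J, Y q^J and the same [t], up to K = M - J; its lower parameter is e q^(2J). *)
Lemma bailey_finite (q e X Y t : C) (al be : nat -> C) :
  (forall k, 1 - q * q ^ k <> 0) ->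
  (forall k, 1 - e * q ^ k <> 0) ->
  (forall k, 1 - X * t * q ^ k <> 0) ->
  (forall k, 1 - Y * t * q ^ k <> 0) ->
  e = X * Y * t ->
  bailey_pair q e al be ->
  bailey_pair q e
    (fun J => qpoch X q J * qpoch Y q J * t ^ J
              / (qpoch (X * t) q J * qpoch (Y * t) q J) * al J)
    (fun M => / (qpoch (X * t) q M * qpoch (Y * t) q M) *
       csum (fun n => qpoch X q n * qpoch Y q n * t ^ n * qpoch t q (M - n)
                       / qpoch q q (M - n) * be n) M).
Proof.
  intros Hq He HX HY Ee Hb M.
  assert (Nq : forall k, qpoch q q k <> 0) by (intros; now apply qpoch_nz).
  assert (Ne : forall k, qpoch e q k <> 0) by (intros; now apply qpoch_nz).
  assert (NX : forall k, qpoch (X * t) q k <> 0) by (intros; now apply qpoch_nz).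
  assert (NY : forall k, qpoch (Y * t) q k <> 0) by (intros; now apply qpoch_nz).
  pose (g J m := qpoch X q (J + m) * qpoch Y q (J + m) * t ^ (J + m)
    * qpoch t q (M - (J + m)) / qpoch q q (M - (J + m))
    * (al J / (qpoch q q m * qpoch e q (J + m + J)))).
  rewrite (csum_ext _ (fun n => csum (fun J => g J (n - J)%nat) n)).
  2: { intros n Hn. rewrite Hb, <- csum_mult_l. apply csum_ext. intros J HJ.
       unfold g. now replace (J + (n - J))%nat with n by lia. }
  rewrite csum_triangle, <- csum_mult_l. apply csum_ext. intros J HJ.
  rewrite (csum_ext _ (fun i => (qpoch X q J * qpoch Y q J * t ^ J * al J
     / qpoch e q (2 * J)) * 
     (t ^ i * qpoch (X * q ^ J) q i * qpoch (Y * q ^ J) q i 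
     * qpoch t q (M - J - i) / (qpoch q q (M - J - i) * qpoch q q i *
        qpoch (X * q ^ J * (Y * q ^ J) * t) q i)))).
  2: { intros i Hi. unfold g. 
       replace (M - (J + i))%nat with (M - J - i)%nat by lia.
       replace (J + i + J)%nat with (2 * J + i)%nat by lia.
       replace (X * q ^ J * (Y * q ^ J) * t) with (e * q ^ (2 * J)).
       2: { rewrite Nat.mul_comm, Cpow_mult_r, Ee. ring. }
       pose proof (Ne (2 * J + i)%nat) as N1.
       rewrite !(qpoch_add _ _ J i), (qpoch_add e), Cpow_add_r.
       rewrite qpoch_add in N1.
       field. repeat split; try apply Nq; intros Z; apply N1; rewrite Z; ring. }
  replace (X * q ^ J * (Y * q ^ J) * t) with (e * q ^ (2 * J)).
  2: { rewrite Nat.mul_comm, Cpow_mult_r, Ee. ring. }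
  rewrite csum_mult_l.
  assert (E2 : e * q ^ (2 * J) = X * q ^ J * (Y * q ^ J) * t).
  { rewrite Nat.mul_comm, Cpow_mult_r, Ee. ring. }
  rewrite E2, saalschutz, <- E2.
  2: assumption.
  2: { intros k. rewrite <- E2, <- Cmult_assoc, <- Cpow_add_r. apply He. }
  replace (M + J)%nat with (2 * J + (M - J))%nat by lia.
  replace (qpoch (X * t) q M) with (qpoch (X * t) q (J + (M - J))) by (f_equal; lia).
  replace (qpoch (Y * t) q M) with (qpoch (Y * t) q (J + (M - J))) by (f_equal; lia).
  pose proof (Ne (2 * J + (M - J))%nat) as N1.
  pose proof (NX (J + (M - J))%nat) as N2.
  pose proof (NY (J + (M - J))%nat) as N3.
  rewrite !(qpoch_add _ _ _ (M - J)) in *.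
  replace (X * q ^ J * t) with (X * t * q ^ J) by ring.
  replace (Y * q ^ J * t) with (Y * t * q ^ J) by ring.
  field. repeat split; try apply Nq; try apply NX; try apply NY; try apply Ne;
    intros Z; solve [apply N1; rewrite Z; ring | apply N2; rewrite Z; ring
                   | apply N3; rewrite Z; ring].
Qed.

(** * The quadratic Bailey pair *)

(* The [lambda]-part of the summand of the right-hand side, after cancelling
   [(alpha;q)_2j = (alpha, q alpha; q^2)_j] and [(q;q)_2j = (q, q^2; q^2)_j]. *)
Definition quad_alpha (q alpha lam : C) (j : nat) : C :=
  (1 - alpha * q ^ (4 * j)) * qpoch alpha (q ^ 2) j
  / ((1 - alpha) * qpoch (q ^ 2) (q ^ 2) j)
  * (qpoch (q * alpha / lam) (q ^ 2) j * lam ^ j / qpoch (q * lam) (q ^ 2) j)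
  * q ^ (2 * j ^ 2 - j).

(* [Q] stands for [q^n]; the last product is the WZ antidifference. *)
Lemma quad_partial (q alpha lam Q : C) :
  q <> 0 -> lam <> 0 -> 1 - alpha <> 0 ->
  (forall k, 1 - q * q ^ k <> 0) ->
  (forall k, 1 - q * lam * (q ^ 2) ^ k <> 0) ->
  (forall k, 1 - q * alpha * Q * q ^ k <> 0) ->
  let f Q j := quad_alpha q alpha lam j * qpoch Q (/ q) (2 * j)
               / qpoch (q * alpha * Q) q (2 * j) in
  forall j,
  (1 - lam * Q) * (1 - q * alpha * Q ^ 2) * csum (f (q * Q)) j =
  (1 - q * alpha * Q) * (1 - lam * Q ^ 2) * csum (f Q) j
  - Q * qpoch alpha (q ^ 2) (S j) / ((1 - alpha) * qpoch (q ^ 2) (q ^ 2) j)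
  * (qpoch (q * alpha / lam) (q ^ 2) (S j) * lam ^ (S j)
     / qpoch (q * lam) (q ^ 2) j)
  * (qpoch Q (/ q) (S (2 * j)) / qpoch (q * alpha * (q * Q)) q (2 * j))
  * q ^ (2 * j ^ 2 + j).
Proof.
  intros Hq0 Hl Ha Hq Hql He f.
  assert (Hq2 : forall k, 1 - q ^ 2 * (q ^ 2) ^ k <> 0).
  { intros k. replace (q ^ 2 * (q ^ 2) ^ k) with (q * q ^ (S (2 * k))).
    apply Hq. rewrite Cpow_S, Cpow_mult_r. ring. }
  assert (Nq : forall k, qpoch (q ^ 2) (q ^ 2) k <> 0) by (intros; now apply qpoch_nz).
  assert (Nl : forall k, qpoch (q * lam) (q ^ 2) k <> 0) by (intros; now apply qpoch_nz).
  assert (He' : forall k, 1 - q * alpha * (q * Q) * q ^ k <> 0).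
  { intros k. replace (q * alpha * (q * Q) * q ^ k) with (q * alpha * Q * q ^ S k).
    apply He. rewrite Cpow_S. ring. }
  assert (Ne : forall k, qpoch (q * alpha * (q * Q)) q k <> 0) by (intros; now apply qpoch_nz).
  induction j as [|j IH].
  - rewrite !csum_O. unfold f, quad_alpha. simpl. field. repeat split; trivial; exact C1_nz.
  - rewrite !csum_S, !Cmult_plus_distr_l, IH. unfold f, quad_alpha.
    replace (2 * S j)%nat with (S (S (2 * j))) by lia.
    (* Taking the first factor out turns the symbols at q Q and at Q into multiples of the common
       ones (Q;1/q)_2j and (q alpha q Q;q)_2j. *)
    rewrite (qpoch_S_l (q * Q)), (qpoch_S_l (q * alpha * Q)).
    replace (q * Q * / q) with Q by (field; assumption).
    replace (q * alpha * Q * q) with (q * alpha * (q * Q)) by ring.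
    (* The exponents are split so that every power of q becomes q^(2j^2+j), or a power of Z =
       q^(2j), times a constant power; [field] then sees a rational identity in independent
       atoms. *)
    replace (4 * S j)%nat with (4 + (2 * j + 2 * j))%nat by lia.
    replace (2 * S j ^ 2 - S j)%nat with ((2 * j ^ 2 + j) + (1 + 2 * j))%nat by (simpl; nia).
    replace (2 * S j ^ 2 + S j)%nat with ((2 * j ^ 2 + j) + (3 + 2 * (2 * j)))%nat by (simpl; nia).
    rewrite (Cpow_add_r q (2 * j ^ 2 + j) (1 + _)), (Cpow_add_r q (2 * j ^ 2 + j) (3 + _)).
    rewrite !(Cpow_add_r q _ (_ + _)), !(Cpow_add_r q _ (2 * _)), (Cpow_mult_r q 2 (2 * j)), (Cpow_sqr_comm q (2 * j)).
    rewrite !qpoch_S, !Cpow_inv by assumption.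
    rewrite !(Cpow_S _ (S (2 * j))), !(Cpow_S _ (2 * j)), (Cpow_S lam (S j)), !(Cpow_S _ j).
    assert (HZ : q ^ (2 * j) <> 0) by now apply Cpow_nz.
    assert (EZ : (q ^ 2) ^ j = q ^ (2 * j)) by now rewrite Cpow_mult_r.
    generalize (Nq j) (Nl j) (Ne (2 * j)%nat) (Hq2 j) (Hql j) (He' (2 * j)%nat) (He' (S (2 * j))) (He O).
    rewrite !EZ, (Cpow_S _ (2 * j)). simpl (q ^ 0). rewrite Cmult_1_r.
    generalize dependent (q ^ (2 * j)). intros Z HZ EZ.
    generalize (qpoch (q ^ 2) (q ^ 2) j) (qpoch (q * lam) (q ^ 2) j)
      (qpoch (q * alpha * (q * Q)) q (2 * j)) (qpoch alpha (q ^ 2) j)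
      (qpoch (q * alpha / lam) (q ^ 2) j) (lam ^ j) (qpoch Q (/ q) (2 * j))
      (q ^ (2 * j ^ 2 + j)).
    match goal with |- context [csum ?f j] => generalize (csum f j) end.
    intros. field. repeat split; assumption.
Qed.

(** Since (Q;1/q)_2j and (q alpha Q;q)_2j each split into two symbols in base q^2, this is the
    very-well-poised 6-phi-5 with parameters q alpha/lam, q^(-n), q^(1-n). The end N is kept apart
    from n because the recurrence compares n and n + 1 at equal length; the bound on n makes
    (q^n;1/q)_(2N+1), and with it the antidifference, vanish in each step. *)
Lemma quad_sum (q alpha lam : C) N n :
  q <> 0 -> lam <> 0 -> 1 - alpha <> 0 ->
  (forall k, 1 - q * q ^ k <> 0) ->
  (forall k, 1 - lam * q ^ k <> 0) ->
  (forall k, 1 - q * alpha * q ^ k <> 0) ->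
  (n <= S (2 * N))%nat ->
  csum (fun j => quad_alpha q alpha lam j * qpoch (q ^ n) (/ q) (2 * j)
                 / qpoch (q * alpha * q ^ n) q (2 * j)) N
  = qpoch (q * alpha) q n * qpoch lam (q ^ 2) n
    / (qpoch lam q n * qpoch (q * alpha) (q ^ 2) n).
Proof.
  intros Hq0 Hl0 Ha Hq Hl He.
  assert (Hql : forall k, 1 - q * lam * (q ^ 2) ^ k <> 0).
  { intros k. replace (q * lam * (q ^ 2) ^ k) with (lam * q ^ (S (2 * k))).
    apply Hl. rewrite Cpow_S, Cpow_mult_r. ring. }
  assert (He2 : forall k, 1 - q * alpha * (q ^ 2) ^ k <> 0).
  { intros k. rewrite <- Cpow_mult_r. apply He. }
  assert (Heq : forall n k, 1 - q * alpha * q ^ n * q ^ k <> 0).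
  { intros i k. rewrite <- Cmult_assoc, <- Cpow_add_r. apply He. }
  induction n as [|n IH]; intros Hn.
  - rewrite (csum_stationary _ 0); [|lia|].
    + rewrite csum_O. unfold quad_alpha. simpl. field.
      repeat split; try assumption; exact C1_nz.
    + intros k Hk. rewrite qpoch_inv_pow_0 by (trivial; lia). unfold Cdiv. ring.
  - pose proof (quad_partial q alpha lam (q ^ n) Hq0 Hl0 Ha Hq Hql (Heq n) N) as P.
    cbv zeta beta in P. rewrite IH in P by lia.
    rewrite (qpoch_inv_pow_0 q n (S (2 * N))) in P by (trivial; lia).
    assert (Z : forall x : C, 0 / x = 0) by (intros; unfold Cdiv; ring).
    rewrite Z, Cmult_0_r, Cmult_0_l in P.
    change (q ^ S n) with (q * q ^ n).
    match type of P with _ * ?Z = _ => set (Sig := Z) in * end.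
    assert (He2n : 1 - q * alpha * (q ^ n) ^ 2 <> 0)
      by (rewrite <- Cpow_sqr_comm; apply He2).
    assert (E : Sig = ((1 - lam * q ^ n) * (1 - q * alpha * (q ^ n) ^ 2) * Sig)
      / ((1 - lam * q ^ n) * (1 - q * alpha * (q ^ n) ^ 2))).
    { field. split; [assumption | apply Hl]. }
    rewrite E, P, !qpoch_S, !Cpow_sqr_comm.
    assert (N1 : qpoch lam q n <> 0) by (apply qpoch_nz, Hl).
    assert (N2 : qpoch (q * alpha) (q ^ 2) n <> 0) by (apply qpoch_nz, He2).
    specialize (Hl n).
    field. repeat split; assumption.
Qed.

Lemma quad_bailey_pair (q alpha lam : C) :
  q <> 0 -> lam <> 0 -> 1 - alpha <> 0 ->
  (forall k, 1 - q * q ^ k <> 0) ->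
  (forall k, 1 - lam * q ^ k <> 0) ->
  (forall k, 1 - q * alpha * q ^ k <> 0) ->
  bailey_pair q (q * alpha)
    (fun J => if Nat.even J then quad_alpha q alpha lam (Nat.div2 J) else 0)
    (fun n => qpoch lam (q ^ 2) n
      / (qpoch q q n * qpoch lam q n * qpoch (q * alpha) (q ^ 2) n)).
Proof.
  intros Hq0 Hl0 Ha Hq Hl He n.
  assert (Nq : forall k, qpoch q q k <> 0) by (intros; now apply qpoch_nz).
  assert (Ne : forall k, qpoch (q * alpha) q k <> 0) by (intros; now apply qpoch_nz).
  assert (Nl : forall k, qpoch lam q k <> 0) by (intros; now apply qpoch_nz).
  assert (Ne2 : forall k, qpoch (q * alpha) (q ^ 2) k <> 0).
  { intros; apply qpoch_nz. intros. rewrite <- Cpow_mult_r. apply He. }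
  pose (f j := quad_alpha q alpha lam j * qpoch (q ^ n) (/ q) (2 * j)
                 / qpoch (q * alpha * q ^ n) q (2 * j)).
  assert (E : csum f n = qpoch (q * alpha) q n * qpoch lam (q ^ 2) n
    / (qpoch lam q n * qpoch (q * alpha) (q ^ 2) n)).
  { apply (quad_sum q alpha lam n n); trivial. apply Nat.le_le_succ_r. lia. }
  (* The sum now runs over all J up to 2n + 1; it stops at n because (q^n;1/q)_J vanishes for J >
     n. *)
  rewrite <- csum_even, (csum_stationary _ n) in E; [|lia|].
  2: { intros k Hk. destruct (Nat.even k) eqn:Ev; [|reflexivity].
       unfold f. apply Nat.even_spec in Ev as [j ->].
       rewrite Nat.div2_double, qpoch_inv_pow_0 by assumption. unfold Cdiv. ring. }
  rewrite (csum_ext _ (fun J => / (qpoch q q n * qpoch (q * alpha) q n) *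
    (if Nat.even J then f (Nat.div2 J) else 0))).
  - rewrite csum_mult_l, E. field. repeat split; auto.
  - intros J HJ. destruct (Nat.even J) eqn:Ev; [|unfold Cdiv; ring].
    apply Nat.even_spec in Ev as [j ->]. rewrite Nat.div2_double. unfold f.
    rewrite <- (qpoch_inv_pow q n (2 * j)) by assumption.
    pose proof (Nq n) as N1. pose proof (Ne (n + 2 * j)%nat) as N2.
    rewrite <- (qpoch_inv_pow q n (2 * j)) in N1 by assumption.
    rewrite qpoch_add in *.
    field. repeat split; auto; intros Z; solve [apply N1; rewrite Z; ring | apply N2; rewrite Z; ring].
Qed.

(** * Limits and series in C *)

Definition clim (u : nat -> C) (l : C) : Prop := filterlim u eventually (locally l).

Definition Cis_series (u : nat -> C) (l : C) : Prop :=
  @is_series C_AbsRing C_NormedModule u l.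

Lemma clim_parts (u : nat -> C) (l : C) :
  clim u l <->
  is_lim_seq (fun n => Re (u n)) (Re l) /\ is_lim_seq (fun n => Im (u n)) (Im l).
Proof.
  split.
  - intros H. split; intros P [e He].
    + apply (H (fun z => P (Re z))). exists e. intros z [Hz _]. now apply He.
    + apply (H (fun z => P (Im z))). exists e. intros z [_ Hz]. now apply He.
  - intros [H1 H2]. apply filterlim_locally. intros eps.
    apply (filter_imp (fun n => ball (Re l) eps (Re (u n)) /\ ball (Im l) eps (Im (u n)))).
    + intros n [A1 A2]. split; assumption.
    + apply filter_and.
      * now apply (proj1 (filterlim_locally (F := eventually) _ (Re l))).
      * now apply (proj1 (filterlim_locally (F := eventually) _ (Im l))).
Qed.

Lemma clim_unique u l1 l2 : clim u l1 -> clim u l2 -> l1 = l2.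
Proof. intros H1 H2. rewrite <- (CLim_correct u l1 H1). now apply CLim_correct. Qed.

Lemma clim_const c : clim (fun _ => c) c.
Proof. apply filterlim_const. Qed.

Lemma clim_ext u v l : (forall n, u n = v n) -> clim u l -> clim v l.
Proof. intros H. now apply filterlim_ext. Qed.

Lemma clim_plus u v l m :
  clim u l -> clim v m -> clim (fun n => u n + v n) (l + m).
Proof.
  intros Hu Hv. apply clim_parts in Hu as [H1 H2].
  apply clim_parts in Hv as [H3 H4]. apply clim_parts. split; simpl; now apply (is_lim_seq_plus' _ _ _ _).
Qed.

Lemma clim_mult u v l m :
  clim u l -> clim v m -> clim (fun n => u n * v n) (l * m).
Proof.
  intros Hu Hv. apply clim_parts in Hu as [H1 H2].
  apply clim_parts in Hv as [H3 H4]. apply clim_parts. split; simpl;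
    [apply is_lim_seq_minus' | apply is_lim_seq_plus']; now apply (is_lim_seq_mult' _ _ _ _).
Qed.

Lemma clim_inv (u : nat -> C) (l : C) : l <> 0 -> clim u l -> clim (fun n => / u n) (/ l).
Proof.
  intros Hl Hu. apply clim_parts in Hu as [H1 H2]. apply clim_parts.
  assert (D : is_lim_seq (fun n => (Re (u n) ^ 2 + Im (u n) ^ 2)%R) (Re l ^ 2 + Im l ^ 2)%R).
  { simpl. apply is_lim_seq_plus'; repeat apply is_lim_seq_mult'; trivial; apply is_lim_seq_const. }
  assert (Dl : (Re l ^ 2 + Im l ^ 2)%R <> 0%R).
  { intros E. apply Hl. destruct l as [x y]. simpl in E.
    assert (x = 0%R) by nra. assert (y = 0%R) by nra. now subst. }
  split.
  - exact (is_lim_seq_div' _ _ _ _ H1 D Dl).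
  - apply (is_lim_seq_div' _ _ (- Im l)%R _); trivial.
    now apply (is_lim_seq_opp _ (Im l)).
Qed.

Lemma clim_div (u v : nat -> C) (l m : C) :
  m <> 0 -> clim u l -> clim v m -> clim (fun n => u n / v n) (l / m).
Proof. intros. apply clim_mult; trivial. now apply clim_inv. Qed.

Lemma clim_shift u l k : clim u l -> clim (fun n => u (n - k)%nat) l.
Proof.
  intros H. apply (filterlim_comp _ _ _ (fun n => (n - k)%nat) u _ eventually); trivial.
  intros P [N HN]. exists (N + k)%nat. intros n Hn. apply HN. lia.
Qed.

Lemma clim_subseq u l (phi : nat -> nat) :
  (forall n, (n <= phi n)%nat) -> clim u l -> clim (fun n => u (phi n)) l.
Proof.
  intros Hphi H. apply (filterlim_comp _ _ _ phi u _ eventually); trivial.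
  intros P [N HN]. exists N. intros n Hn. apply HN. specialize (Hphi n). lia.
Qed.

Lemma clim_eps u l :
  clim u l <-> forall eps : R, (0 < eps)%R ->
    exists N, forall n, (N <= n)%nat -> (Cmod (u n - l) < eps)%R.
Proof.
  unfold clim. split.
  - intros H eps He.
    pose proof (proj1 (filterlim_locally_ball_norm (U := C_NormedModule) u l) H (mkposreal eps He)) as [N HN].
    exists N. exact HN.
  - intros H. apply (filterlim_locally_ball_norm (U := C_NormedModule)). intros [eps He].
    destruct (H eps He) as [N HN]. exists N. exact HN.
Qed.

Lemma clim_Cmod u l : clim u l -> is_lim_seq (fun n => Cmod (u n)) (Cmod l).
Proof.
  rewrite clim_eps. intros H. apply is_lim_seq_spec. intros [eps He].
  destruct (H eps He) as [N HN]. exists N. intros n Hn.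
  eapply Rle_lt_trans; [|exact (HN n Hn)].
  exact (norm_triangle_inv (V := C_NormedModule) (u n) l).
Qed.

Lemma clim_Cmod_le u l B :
  clim u l -> (exists N, forall n, (N <= n)%nat -> (Cmod (u n) <= B)%R) -> (Cmod l <= B)%R.
Proof.
  intros H [N HN].
  apply (is_lim_seq_le_loc (fun n => Cmod (u n)) (fun _ => B) (Cmod l) B).
  - now exists N.
  - now apply clim_Cmod.
  - apply is_lim_seq_const.
Qed.

Lemma clim_csum (u : nat -> nat -> C) l N :
  (forall m, clim (fun K => u K m) (l m)) -> clim (fun K => csum (u K) N) (csum l N).
Proof.
  intros H. induction N as [|N IH].
  - rewrite csum_O. apply clim_ext with (2 := H 0%nat). intros. now rewrite csum_O.
  - rewrite csum_S. apply clim_ext with (2 := clim_plus _ _ _ _ IH (H (S N))).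
    intros. now rewrite csum_S.
Qed.

Lemma Cis_series_scal c u l : Cis_series u l -> Cis_series (fun n => c * u n) (c * l).
Proof. exact (is_series_scal (V := C_NormedModule) c u l). Qed.

Lemma Cis_series_ext u v l : (forall n, u n = v n) -> Cis_series u l -> Cis_series v l.
Proof. exact (is_series_ext (V := C_NormedModule) u v l). Qed.

Lemma ex_Cseries_le (u : nat -> C) (B : nat -> R) :
  (forall n, (Cmod (u n) <= B n)%R) -> ex_series B -> exists l, Cis_series u l.
Proof. exact (ex_series_le (V := C_CompleteNormedModule) u B). Qed.

Lemma csum_tail_bound (u : nat -> C) (B : nat -> R) N K :
  (N <= K)%nat -> (forall m, (m <= K)%nat -> (Cmod (u m) <= B m)%R) ->
  (Cmod (csum u K - csum u N) <= sum_n B K - sum_n B N)%R.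
Proof.
  intros HK. induction HK as [|K HK IH]; intros Hu.
  - replace (csum u N - csum u N) with (RtoC 0) by ring. rewrite Cmod_0. lra.
  - rewrite csum_S, (sum_Sn B). unfold plus; simpl.
    replace (csum u K + u (S K) - csum u N) with ((csum u K - csum u N) + u (S K)) by ring.
    eapply Rle_trans; [apply Cmod_triangle|].
    specialize (Hu (S K) (Nat.le_refl _)) as Hl.
    assert (Cmod (csum u K - csum u N) <= sum_n B K - sum_n B N)%R by (apply IH; auto).
    lra.
Qed.

(** Dominated convergence for a sum whose terms and length both depend on K. The majorant is asked
    for m <= K only, where K - m is a true difference; each limit [l m] inherits it because m is
    fixed while K grows. *)
Lemma tannery (u : nat -> nat -> C) (l : nat -> C) (B : nat -> R) :
  ex_series B ->
  (forall K m, (m <= K)%nat -> (Cmod (u K m) <= B m)%R) ->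
  (forall m, clim (fun K => u K m) (l m)) ->
  exists S, Cis_series l S /\ clim (fun K => csum (u K) K) S.
Proof.
  intros HB Hu Hl.
  assert (HlB : forall m, (Cmod (l m) <= B m)%R).
  { intros m. apply (clim_Cmod_le _ _ _ (Hl m)). exists m. auto. }
  destruct (ex_Cseries_le l B HlB HB) as [S HS].
  exists S. split; [exact HS|].
  destruct HB as [b Hb].
  apply clim_eps. intros eps He.
  (* The tail beyond N costs two quarters, one for each partial sum of [B]; the other two go to the
     convergence of the first N + 1 terms and to the tail of [l]. *)
  assert (He4 : (0 < eps / 4)%R) by lra.
  change (is_lim_seq (sum_n B) b) in Hb. apply is_lim_seq_spec in Hb.
  destruct (Hb (mkposreal _ He4)) as [N1 HN1]. simpl in HN1.
  destruct (proj1 (clim_eps _ _) HS _ He4) as [N2 HN2].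
  set (N := Nat.max N1 N2).
  destruct (proj1 (clim_eps _ _) (clim_csum u l N Hl) _ He4) as [N3 HN3].
  exists (Nat.max N N3). intros K HK.
  pose proof (csum_tail_bound (u K) B N K ltac:(lia) (Hu K)) as T.
  specialize (HN3 K ltac:(lia)).
  specialize (HN2 N ltac:(lia)).
  pose proof (HN1 N ltac:(lia)) as B1. pose proof (HN1 K ltac:(lia)) as B2.
  apply Rabs_def2 in B1. apply Rabs_def2 in B2.
  replace (csum (u K) K - S) with
    ((csum (u K) K - csum (u K) N) + ((csum (u K) N - csum l N) + (csum l N - S))) by ring.
  eapply Rle_lt_trans; [apply Cmod_triangle|].
  eapply Rle_lt_trans; [apply Rplus_le_compat_l, Cmod_triangle|].
  change (sum_n l N) with (csum l N) in HN2.
  lra.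
Qed.

Lemma csum_bound (u : nat -> C) (B : nat -> R) K :
  (forall m, (Cmod (u m) <= B m)%R) -> (Cmod (csum u K) <= sum_n B K)%R.
Proof.
  intros Hu. induction K as [|K IH].
  - rewrite csum_O, sum_O. apply Hu.
  - rewrite csum_S, sum_Sn. eapply Rle_trans; [apply Cmod_triangle|].
    apply Rplus_le_compat; auto.
Qed.

(** By [csum_triangle] a partial sum along antidiagonals is a sum of truncated rows. Each truncated
    row is at most V times [u n], where V is the sum of [v], so [tannery] applies. *)
Lemma series_triangle (g : nat -> nat -> C) (G : nat -> C) (u v : nat -> R) :
  (forall n, (0 <= u n)%R) -> (forall n, (0 <= v n)%R) ->
  (forall n m, (Cmod (g n m) <= u n * v m)%R) ->
  ex_series u -> ex_series v ->
  (forall n, Cis_series (g n) (G n)) ->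
  exists S, Cis_series G S /\
    Cis_series (fun M => csum (fun n => g n (M - n)%nat) M) S.
Proof.
  intros Hu0 Hv0 Hg Hu [V HV] HG.
  assert (HVn : forall n, (sum_n v n <= V)%R).
  { apply is_lim_seq_incr_compare; [exact HV|].
    intros n. rewrite sum_Sn. unfold plus; simpl. specialize (Hv0 (S n)). lra. }
  assert (HV0 : (0 <= V)%R).
  { specialize (HVn 0%nat). rewrite sum_O in HVn. specialize (Hv0 0%nat). lra. }
  destruct (tannery (fun K n => csum (g n) (K - n)) G (fun n => (V * u n)%R))
    as [S [H1 H2]].
  - exact (ex_series_scal_l V u Hu).
  - intros K n _. eapply Rle_trans; [apply (csum_bound _ _ _ (Hg n))|].
    rewrite (sum_n_mult_l (K := R_Ring) (u n) v).
    rewrite (Rmult_comm V). now apply Rmult_le_compat_l.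
  - intros n. exact (clim_shift _ _ n (HG n)).
  - exists S. split; [exact H1|].
    apply clim_ext with (2 := H2). intros N. symmetry. apply csum_triangle.
Qed.

Definition bdd (f : nat -> C) : Prop := exists B : R, forall n, (Cmod (f n) <= B)%R.

Lemma bdd_const c : bdd (fun _ => c).
Proof. exists (Cmod c). intros; lra. Qed.

Lemma bdd_mult f g : bdd f -> bdd g -> bdd (fun n => f n * g n).
Proof.
  intros [A HA] [B HB]. exists (A * B)%R. intros n. rewrite Cmod_mult.
  apply Rmult_le_compat; auto using Cmod_ge_0.
Qed.

Lemma bdd_ext f g : (forall n, f n = g n) -> bdd f -> bdd g.
Proof. intros E [A HA]. exists A. intros n. now rewrite <- E. Qed.

Lemma bdd_geom (z : C) : (Cmod z <= 1)%R -> bdd (fun n => z ^ n).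
Proof.
  intros Hz. exists 1%R. intros n. rewrite Cmod_pow, <- (pow1 n).
  apply pow_incr. split; [apply Cmod_ge_0 | exact Hz].
Qed.

Lemma exp_le x y : (x <= y)%R -> (exp x <= exp y)%R.
Proof. intros [H| ->]; [left; now apply exp_increasing | apply Rle_refl]. Qed.

(** * Bounds for q-shifted factorials *)

Lemma Cmod_q_pow (q : R) (hq : (0 < q < 1)%R) k : Cmod (q ^ k) = (q ^ k)%R.
Proof. rewrite Cmod_pow, Cmod_R, Rabs_pos_eq; lra. Qed.

Lemma pow_q_bounds (q : R) (hq : (0 < q < 1)%R) k : (0 < q ^ k <= 1)%R.
Proof.
  split; [apply pow_lt; lra|]. rewrite <- (pow1 k). apply pow_incr; lra.
Qed.

Lemma one_minus_nz (q : R) (hq : (0 < q < 1)%R) z k : (Cmod z < 1)%R -> 1 - z * q ^ k <> 0.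
Proof.
  intros Hz E. assert (E1 : z * q ^ k = 1).
  { replace (z * q ^ k) with (1 - (1 - z * q ^ k)) by ring. rewrite E. ring. }
  apply (f_equal Cmod) in E1. rewrite Cmod_mult, (Cmod_q_pow q hq), Cmod_1 in E1.
  pose proof (pow_q_bounds q hq k). pose proof (Cmod_ge_0 z). nra.
Qed.

(** Each factor satisfies 1 + y <= exp y. The exponent carries the exact geometric partial sum, so
    that the induction closes. *)
Lemma qpoch_upper (q : R) (hq : (0 < q < 1)%R) x n :
  (Cmod (qpoch x q n) <= exp (Cmod x * (1 - q ^ n) / (1 - q)))%R.
Proof.
  induction n as [|n IH].
  - simpl. rewrite Cmod_1.
    replace (Cmod x * (1 - 1) / (1 - q))%R with 0%R by (field; lra). rewrite exp_0. lra.
  - rewrite qpoch_S, Cmod_mult.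
    replace (Cmod x * (1 - q ^ S n) / (1 - q))%R with
      (Cmod x * (1 - q ^ n) / (1 - q) + Cmod x * q ^ n)%R by (simpl; field; lra).
    rewrite exp_plus. apply Rmult_le_compat; auto using Cmod_ge_0.
    eapply Rle_trans; [apply Cmod_triangle|].
    rewrite Cmod_opp, Cmod_mult, (Cmod_q_pow q hq), Cmod_1. apply exp_ineq1_le.
Qed.

Lemma qpoch_upper_unif (q : R) (hq : (0 < q < 1)%R) x n :
  (Cmod (qpoch x q n) <= exp (Cmod x / (1 - q)))%R.
Proof.
  eapply Rle_trans; [apply (qpoch_upper q hq)|]. apply exp_le.
  unfold Rdiv. apply Rmult_le_compat_r; [left; apply Rinv_0_lt_compat; lra|].
  pose proof (pow_q_bounds q hq n). pose proof (Cmod_ge_0 x). nra.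
Qed.

Lemma bdd_qpoch (q : R) (hq : (0 < q < 1)%R) x : bdd (qpoch x q).
Proof. eexists. intros n. apply (qpoch_upper_unif q hq). Qed.

(** The Weierstrass inequality: a product of factors 1 - y_k with all y_k in [0, 1] is at least 1
    minus the sum of the y_k. *)
Lemma qpoch_lower_small (q : R) (hq : (0 < q < 1)%R) x n : (Cmod x / (1 - q) <= 1)%R ->
  (1 - Cmod x * (1 - q ^ n) / (1 - q) <= Cmod (qpoch x q n))%R.
Proof.
  intros Hx. pose proof (Cmod_ge_0 x) as Hx0.
  assert (Hi : (0 < / (1 - q))%R) by (apply Rinv_0_lt_compat; lra).
  induction n as [|n IH].
  - simpl. rewrite Cmod_1. unfold Rdiv. lra.
  - rewrite qpoch_S, Cmod_mult.
    assert (H1 : (1 - Cmod x * q ^ n <= Cmod (1 - x * q ^ n))%R).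
    { pose proof (Cmod_triangle (1 - x * q ^ n) (x * q ^ n)) as T.
      replace (1 - x * q ^ n + x * q ^ n) with (RtoC 1) in T by ring.
      rewrite Cmod_1, Cmod_mult, (Cmod_q_pow q hq) in T. lra. }
    pose proof (pow_q_bounds q hq n) as Hn.
    set (s := (Cmod x * (1 - q ^ n) / (1 - q))%R) in *.
    replace (Cmod x * (1 - q ^ S n) / (1 - q))%R with (s + Cmod x * q ^ n)%R
      by (unfold s; simpl; field; lra).
    assert (Hs : (0 <= s)%R).
    { unfold s, Rdiv. apply Rmult_le_pos; [apply Rmult_le_pos|]; lra. }
    assert (Hs1 : (s <= 1)%R).
    { eapply Rle_trans; [|exact Hx]. unfold s, Rdiv.
      apply Rmult_le_compat_r; [lra|]. nra. }
    assert (Hx1 : (Cmod x <= 1)%R).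
    { apply (Rmult_le_compat_r (1 - q)) in Hx; [|lra].
      unfold Rdiv in Hx. rewrite Rmult_assoc, Rinv_l in Hx; lra. }
    set (P := Cmod (qpoch x q n)) in *. set (D := Cmod (1 - x * q ^ n)) in *.
    set (y := (Cmod x * q ^ n)%R) in *.
    assert (0 <= y <= 1)%R by (unfold y; nra).
    assert ((1 - s) * (1 - y) <= P * D)%R by (apply Rmult_le_compat; lra).
    nra.
Qed.

(** For large K the argument x q^K is small enough for the Weierstrass bound, which leaves a factor
    at least 1/2 after the first K factors. This bounds inverse symbols uniformly and keeps infinite
    products away from zero. *)
Lemma qpoch_lower (q : R) (hq : (0 < q < 1)%R) x : (forall k, 1 - x * q ^ k <> 0) ->
  exists D, (0 < D)%R /\ forall n, (D <= Cmod (qpoch x q n))%R.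
Proof.
  intros Hx.
  assert (HK : exists K, (Cmod x * q ^ K / (1 - q) <= 1 / 2)%R).
  { assert (L : is_lim_seq (fun K => (Cmod x / (1 - q) * q ^ K)%R) 0%R).
    { replace (Finite 0) with (Rbar_mult (Cmod x / (1 - q))%R 0%R) by (simpl; f_equal; ring).
      apply is_lim_seq_scal_l, is_lim_seq_geom. rewrite Rabs_pos_eq; lra. }
    apply is_lim_seq_spec in L.
    destruct (L (mkposreal (1/2) ltac:(lra))) as [K HK].
    exists K. specialize (HK K (Nat.le_refl _)). simpl in HK.
    apply Rabs_def2 in HK. unfold Rdiv in *. lra. }
  destruct HK as [K HK].
  pose proof (proj1 (Cmod_gt_0 _) (qpoch_nz x q K Hx)) as HP.
  set (P := Cmod (qpoch x q K)) in *.
  set (E := exp (Cmod x / (1 - q))).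
  assert (HE : (1 <= E)%R).
  { unfold E. rewrite <- exp_0 at 1. apply exp_le. apply Rmult_le_pos; [apply Cmod_ge_0|].
    left; apply Rinv_0_lt_compat; lra. }
  assert (HiE : (0 < / E <= 1)%R).
  { split; [apply Rinv_0_lt_compat; lra|]. rewrite <- Rinv_1. apply Rinv_le_contravar; lra. }
  (* The factor 1/2 serves n >= K. For n < K the K-th symbol is the n-th one times a symbol of
     modulus at most E, which costs 1/E. *)
  exists (P / 2 * / E)%R. split; [apply Rmult_lt_0_compat; lra|]. intros n.
  destruct (Nat.le_gt_cases K n) as [Hn|Hn].
  - replace n with (K + (n - K))%nat by lia. rewrite qpoch_add, Cmod_mult. fold P.
    pose proof (qpoch_lower_small q hq (x * q ^ K) (n - K)) as L.
    rewrite Cmod_mult, (Cmod_q_pow q hq) in L. specialize (L ltac:(lra)).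
    set (y := (Cmod x * q ^ K)%R) in *.
    assert (Hy : (y * (1 - q ^ (n - K)) / (1 - q) <= y / (1 - q))%R).
    { unfold Rdiv. apply Rmult_le_compat_r; [left; apply Rinv_0_lt_compat; lra|].
      pose proof (pow_q_bounds q hq (n - K)). pose proof (pow_q_bounds q hq K).
      pose proof (Cmod_ge_0 x). assert (0 <= y)%R by (unfold y; nra). nra. }
    assert (1 / 2 <= Cmod (qpoch (x * q ^ K) q (n - K)))%R by lra.
    assert (P * (1 / 2) <= P * Cmod (qpoch (x * q ^ K) q (n - K)))%R by (apply Rmult_le_compat_l; lra).
    nra.
  - assert (HPn : (P <= Cmod (qpoch x q n) * E)%R).
    { unfold P. replace K with (n + (K - n))%nat by lia. rewrite qpoch_add, Cmod_mult.
      apply Rmult_le_compat_l; [apply Cmod_ge_0|].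
      eapply Rle_trans; [apply (qpoch_upper_unif q hq)|]. apply exp_le.
      apply Rmult_le_compat_r; [left; apply Rinv_0_lt_compat; lra|].
      rewrite Cmod_mult, (Cmod_q_pow q hq). pose proof (pow_q_bounds q hq n). pose proof (Cmod_ge_0 x). nra. }
    apply (Rmult_le_compat_r (/ E)) in HPn; [|lra].
    rewrite Rmult_assoc, Rinv_r, Rmult_1_r in HPn by lra.
    assert (0 < P * / E)%R by (apply Rmult_lt_0_compat; lra). lra.
Qed.

Lemma bdd_inv_qpoch (q : R) (hq : (0 < q < 1)%R) x :
  (forall k, 1 - x * q ^ k <> 0) -> bdd (fun n => / qpoch x q n).
Proof.
  intros Hx. destruct (qpoch_lower q hq x Hx) as [D [HD HDn]]. exists (/ D)%R. intros n.
  rewrite Cmod_inv by now apply qpoch_nz.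
  apply Rinv_le_contravar; auto.
Qed.

Lemma ex_series_q_pow (q : R) (hq : (0 < q < 1)%R) : ex_series (fun n => (q ^ n)%R).
Proof. apply ex_series_geom. rewrite Rabs_pos_eq; lra. Qed.

(** Consecutive symbols differ by -x q^n (x;q)_n, so they are 1 plus the partial sums of a series
    with a geometric majorant, shifted by one index. *)
Lemma qpoch_inf_correct (q : R) (hq : (0 < q < 1)%R) x : clim (qpoch x q) (qpoch_inf x q).
Proof.
  assert (H : exists l, clim (qpoch x q) l).
  { destruct (ex_Cseries_le (fun n => - x * q ^ n * qpoch x q n)
      (fun n => (Cmod x * exp (Cmod x / (1 - q)) * q ^ n)%R)) as [l Hl].
    - intros n. rewrite !Cmod_mult, Cmod_opp, (Cmod_q_pow q hq).
      pose proof (qpoch_upper_unif q hq x n). pose proof (pow_q_bounds q hq n).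
      pose proof (Cmod_ge_0 x). pose proof (Cmod_ge_0 (qpoch x q n)).
      assert (Cmod x * q ^ n * Cmod (qpoch x q n)
        <= Cmod x * q ^ n * exp (Cmod x / (1 - q)))%R by (apply Rmult_le_compat_l; nra).
      lra.
    - exact (ex_series_scal_l (Cmod x * exp (Cmod x / (1 - q)))%R (fun n => (q ^ n)%R) (ex_series_q_pow q hq)).
    - exists (1 + l).
      assert (H1 : clim (fun n => qpoch x q (S n)) (1 + l)).
      { apply clim_ext with (2 := clim_plus _ _ _ _ (clim_const 1) Hl).
        intros n. change (sum_n (fun n => - x * q ^ n * qpoch x q n) n)
          with (csum (fun n => - x * q ^ n * qpoch x q n) n).
        induction n as [|n IH].
        - rewrite csum_O. simpl. ring.
        - rewrite csum_S, Cplus_assoc, IH, (qpoch_S x q (S n)). ring. }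
      apply clim_parts in H1. apply clim_parts.
      destruct H1 as [H1 H2]. split.
      + now apply is_lim_seq_incr_1.
      + now apply is_lim_seq_incr_1. }
  destruct H as [l Hl]. unfold qpoch_inf. now rewrite (CLim_correct _ _ Hl).
Qed.

Lemma qpoch_inf_nz (q : R) (hq : (0 < q < 1)%R) x :
  (forall k, 1 - x * q ^ k <> 0) -> qpoch_inf x q <> 0.
Proof.
  intros Hx E. destruct (qpoch_lower q hq x Hx) as [D [HD HDn]].
  pose proof (clim_Cmod _ _ (qpoch_inf_correct q hq x)) as L. rewrite E, Cmod_0 in L.
  assert (Rbar_le D 0%R).
  { apply (is_lim_seq_le (fun _ => D) (fun n => Cmod (qpoch x q n))); trivial.
    apply is_lim_seq_const. }
  simpl in H. lra.
Qed.

Lemma qpoch_inf_split (q : R) (hq : (0 < q < 1)%R) x J :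
  qpoch_inf x q = qpoch x q J * qpoch_inf (x * q ^ J) q.
Proof.
  apply (clim_unique (fun n => qpoch x q (J + n))).
  - apply (clim_subseq _ _ (fun n => (J + n)%nat)); [lia | apply (qpoch_inf_correct q hq)].
  - apply clim_ext with (u := fun n => qpoch x q J * qpoch (x * q ^ J) q n).
    + intros n. now rewrite qpoch_add.
    + apply clim_mult; [apply clim_const | apply (qpoch_inf_correct q hq)].
Qed.

(** * Infinite Bailey lemma *)

Lemma ex_series_geom_C (z : C) : (Cmod z < 1)%R -> ex_series (fun n => (Cmod z ^ n)%R).
Proof.
  intros Hz. apply ex_series_geom. rewrite Rabs_pos_eq; auto using Cmod_ge_0.
Qed.

Lemma bdd_pos f : bdd f -> exists B : R, (0 <= B)%R /\ forall n, (Cmod (f n) <= B)%R.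
Proof.
  intros [B HB]. exists B. split; [|exact HB].
  eapply Rle_trans; [apply Cmod_ge_0 | apply (HB 0%nat)].
Qed.

Lemma one_minus_q_nz (q : R) : (0 < q < 1)%R -> forall k, 1 - q * q ^ k <> 0.
Proof.
  intros hq k. apply one_minus_nz; [exact hq|]. rewrite Cmod_R, Rabs_pos_eq; lra.
Qed.

Lemma q_gauss (q : R) (X Y t : C) :
  (0 < q < 1)%R -> (Cmod t < 1)%R -> (forall k, 1 - X * Y * t * q ^ k <> 0) ->
  Cis_series (fun i => t ^ i * (qpoch X q i * qpoch Y q i
                        / (qpoch q q i * qpoch (X * Y * t) q i)))
    (qpoch_inf (X * t) q * qpoch_inf (Y * t) q
     / (qpoch_inf t q * qpoch_inf (X * Y * t) q)).
Proof.
  intros hq ht He.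
  pose proof (one_minus_q_nz q hq) as Hq.
  assert (Ht : forall k, 1 - t * q ^ k <> 0) by (intros; now apply one_minus_nz).
  pose proof (qpoch_inf_nz q hq _ Hq) as Iq.
  pose proof (qpoch_inf_nz q hq _ He) as Ie.
  pose proof (qpoch_inf_nz q hq _ Ht) as It.
  pose (f i := qpoch X q i * qpoch Y q i / (qpoch q q i * qpoch (X * Y * t) q i)).
  pose (h k := qpoch t q k / qpoch q q k).
  assert (Bf : bdd f).
  { apply bdd_ext with (f := fun i => qpoch X q i * qpoch Y q i
        * (/ qpoch q q i * / qpoch (X * Y * t) q i)).
    - intros n. unfold f. field. split; now apply qpoch_nz.
    - repeat apply bdd_mult; auto using bdd_qpoch, bdd_inv_qpoch. }
  assert (Bh : bdd h) by (apply bdd_mult; auto using bdd_qpoch, bdd_inv_qpoch).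
  destruct (bdd_pos f Bf) as [F [F0 HF]]. destruct (bdd_pos h Bh) as [H [H0 HH]].
  destruct (tannery (fun K i => t ^ i * f i * h (K - i)%nat)
    (fun i => t ^ i * f i * (qpoch_inf t q / qpoch_inf q q))
    (fun i => (F * H * Cmod t ^ i)%R)) as [S [H1 H2]].
  - exact (ex_series_scal_l (F * H)%R (fun i => (Cmod t ^ i)%R) (ex_series_geom_C t ht)).
  - intros K i _. rewrite !Cmod_mult, Cmod_pow.
    pose proof (pow_le _ i (Cmod_ge_0 t)).
    replace (F * H * Cmod t ^ i)%R with (Cmod t ^ i * F * H)%R by ring.
    apply Rmult_le_compat; auto using Cmod_ge_0.
    + apply Rmult_le_pos; auto using Cmod_ge_0.
    + now apply Rmult_le_compat_l.
  - intros i. apply clim_mult; [apply clim_const|].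
    apply (clim_shift h). apply clim_div; auto using qpoch_inf_correct.
  - assert (E : S = qpoch_inf (X * t) q * qpoch_inf (Y * t) q
        / (qpoch_inf q q * qpoch_inf (X * Y * t) q)).
    { apply (clim_unique _ _ _ H2).
      apply clim_ext with (u := fun K => qpoch (X * t) q K * qpoch (Y * t) q K
        / (qpoch q q K * qpoch (X * Y * t) q K)).
      - intros K. rewrite <- saalschutz by assumption. apply csum_ext. intros i _.
        unfold f, h. field. repeat split; now apply qpoch_nz.
      - apply clim_div; [now apply Cmult_neq_0| |]; apply clim_mult; auto using qpoch_inf_correct. }
    (* In the limit of the Saalschuetz sum every term keeps the factor (t;q)_oo / (q;q)_oo, the
       limit of [h]; it is divided out here. *)
    apply (Cis_series_scal (qpoch_inf q q / qpoch_inf t q)) in H1.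
    replace (qpoch_inf (X * t) q * qpoch_inf (Y * t) q
      / (qpoch_inf t q * qpoch_inf (X * Y * t) q))
      with (qpoch_inf q q / qpoch_inf t q * S) by (rewrite E; field; auto).
    apply Cis_series_ext with (2 := H1). intros i. fold (f i). field. auto.
Qed.

Lemma bailey_infinite (q : R) (e X Y t : C) (al be : nat -> C) :
  (0 < q < 1)%R -> (Cmod t < 1)%R -> e = X * Y * t ->
  (forall k, 1 - e * q ^ k <> 0) ->
  (forall k, 1 - X * t * q ^ k <> 0) ->
  (forall k, 1 - Y * t * q ^ k <> 0) ->
  bailey_pair q e al be ->
  ex_series (fun J => Cmod (al J)) ->
  exists S,
    Cis_series (fun J => qpoch X q J * qpoch Y q J * t ^ J
                / (qpoch (X * t) q J * qpoch (Y * t) q J) * al J) S /\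
    Cis_series (fun M => qpoch X q M * qpoch Y q M * t ^ M * be M)
      (qpoch_inf (X * t) q * qpoch_inf (Y * t) q
       / (qpoch_inf t q * qpoch_inf e q) * S).
Proof.
  intros hq ht Ee He HX HY Hb Hal.
  pose proof (one_minus_q_nz q hq) as Hq.
  assert (Ht : forall k, 1 - t * q ^ k <> 0) by (intros; now apply one_minus_nz).
  pose proof (qpoch_inf_nz q hq _ He) as Ie.
  pose proof (qpoch_inf_nz q hq _ Ht) as It.
  pose proof (qpoch_inf_nz q hq _ HX) as IX.
  pose proof (qpoch_inf_nz q hq _ HY) as IY.
  assert (Nq : forall k, qpoch q q k <> 0) by (intros; now apply qpoch_nz).
  assert (Ne : forall k, qpoch e q k <> 0) by (intros; now apply qpoch_nz).
  assert (NX : forall k, qpoch (X * t) q k <> 0) by (intros; now apply qpoch_nz).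
  assert (NY : forall k, qpoch (Y * t) q k <> 0) by (intros; now apply qpoch_nz).
  set (cst := qpoch_inf (X * t) q * qpoch_inf (Y * t) q
       / (qpoch_inf t q * qpoch_inf e q)).
  assert (Hcst : cst <> 0).
  { unfold cst. apply Cmult_neq_0; [now apply Cmult_neq_0|].
    intros Z. apply C1_nz.
    rewrite <- (Cinv_r (qpoch_inf t q * qpoch_inf e q)) by now apply Cmult_neq_0.
    rewrite Z. ring. }
  (* Row J of [g] is a q-Gauss sum equal to [cst * T J]; antidiagonal M adds up to the M-th term of
     the beta-series. Bounding t^(J+m) by |t|^m leaves the summability in J to [al] alone. *)
  pose (g J m := al J * (qpoch X q (J + m) * qpoch Y q (J + m) * t ^ (J + m)
     * (/ qpoch q q m * / qpoch e q (2 * J + m)))).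
  pose (T J := qpoch X q J * qpoch Y q J * t ^ J
                / (qpoch (X * t) q J * qpoch (Y * t) q J) * al J).
  destruct (bdd_pos _ (bdd_qpoch q hq X)) as [B1 [P1 H1]].
  destruct (bdd_pos _ (bdd_qpoch q hq Y)) as [B2 [P2 H2]].
  destruct (bdd_pos _ (bdd_inv_qpoch q hq q Hq)) as [B3 [P3 H3]].
  destruct (bdd_pos _ (bdd_inv_qpoch q hq e He)) as [B4 [P4 H4]].
  destruct (series_triangle g (fun J => cst * T J) (fun J => Cmod (al J))
    (fun m => (B1 * B2 * (B3 * B4) * Cmod t ^ m)%R)) as [S' [S1 S2]].
  - intros; apply Cmod_ge_0.
  - intros n. pose proof (pow_le _ n (Cmod_ge_0 t)).
    repeat apply Rmult_le_pos; assumption.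
  - intros J m. unfold g. rewrite !Cmod_mult. apply Rmult_le_compat_l; [apply Cmod_ge_0|].
    replace (B1 * B2 * (B3 * B4) * Cmod t ^ m)%R with
      (B1 * B2 * Cmod t ^ m * (B3 * B4))%R by ring.
    assert (Cmod (t ^ (J + m)) <= Cmod t ^ m)%R.
    { rewrite Cmod_pow, pow_add. pose proof (pow_le _ m (Cmod_ge_0 t)).
      pose proof (pow_incr (Cmod t) 1 J (conj (Cmod_ge_0 t) (Rlt_le _ _ ht))) as L.
      rewrite pow1 in L. nra. }
    repeat (apply Rmult_le_compat || apply Rmult_le_pos || apply Cmod_ge_0); auto.
  - exact Hal.
  - exact (ex_series_scal_l _ (fun i => (Cmod t ^ i)%R) (ex_series_geom_C t ht)).
  - intros J.
    assert (E2 : X * q ^ J * (Y * q ^ J) * t = e * q ^ (2 * J)).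
    { rewrite Nat.mul_comm, Cpow_mult_r, Ee. ring. }
    assert (He2 : forall k, 1 - X * q ^ J * (Y * q ^ J) * t * q ^ k <> 0).
    { intros k. rewrite E2, <- Cmult_assoc, <- Cpow_add_r. apply He. }
    pose proof (q_gauss q (X * q ^ J) (Y * q ^ J) t hq ht He2) as Gs.
    rewrite E2 in Gs.
    apply (Cis_series_scal (al J * (qpoch X q J * qpoch Y q J * t ^ J / qpoch e q (2 * J)))) in Gs.
    replace (X * q ^ J * t) with (X * t * q ^ J) in Gs by ring.
    replace (Y * q ^ J * t) with (Y * t * q ^ J) in Gs by ring.
    match type of Gs with Cis_series _ ?L => replace (cst * T J) with L end.
    + apply Cis_series_ext with (2 := Gs). intros m. unfold g.
      pose proof (Ne (2 * J + m)%nat) as N1. rewrite qpoch_add in N1.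
      rewrite !qpoch_add, Cpow_add_r. field.
      repeat split; auto; intros Z; apply N1; rewrite Z; ring.
    + unfold cst, T.
      rewrite (qpoch_inf_split q hq (X * t) J), (qpoch_inf_split q hq (Y * t) J) in *.
      rewrite (qpoch_inf_split q hq e (2 * J)) in *.
      field. repeat split; auto.
      intros Z; apply Ie; rewrite Z; ring.
  (* The exchange sums the alpha-series multiplied by [cst]; since [cst] is nonzero, convergence
     passes to the series itself. *)
  - exists (S' / cst). split.
    + apply (Cis_series_scal (/ cst)) in S1.
      replace (S' / cst) with (/ cst * S') by (unfold Cdiv; ring).
      apply Cis_series_ext with (2 := S1). intros J. fold (T J). field. assumption.
    + replace (cst * (S' / cst)) with S' by (field; assumption).
      apply Cis_series_ext with (2 := S2). intros M. rewrite (Hb M), <- csum_mult_l.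
      apply csum_ext. intros J HJ. unfold g.
      replace (J + (M - J))%nat with M by lia.
      replace (2 * J + (M - J))%nat with (M + J)%nat by lia.
      field. auto.
Qed.

(** * Absolute summability of the quadratic alpha-side *)

(* [K^n q^(n(n-1)/2)] *)
Fixpoint theta_weight (K q : R) (n : nat) : R :=
  match n with O => 1 | S m => theta_weight K q m * (K * q ^ m) end.

(** The exponent 2j^2 - j is the binomial coefficient of 2j over 2, so the weight at J = 2j has
    exactly the power of q found in [quad_alpha]. *)
Lemma theta_weight_double K q j :
  theta_weight K q (2 * j) = ((K ^ 2) ^ j * q ^ (2 * j ^ 2 - j))%R.
Proof.
  induction j as [|j IH]; [simpl; ring|].
  replace (2 * S j)%nat with (S (S (2 * j))) by lia.
  cbn [theta_weight]. rewrite IH.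
  replace (2 * S j ^ 2 - S j)%nat with ((2 * j ^ 2 - j) + (2 * j + (2 * j + 1)))%nat.
  - rewrite !pow_add. simpl. ring.
  - simpl. nia.
Qed.

(** Successive weights have ratio K q^n, which tends to 0 however large K is. *)
Lemma ex_series_theta_weight K q : (0 < K)%R -> (0 < q < 1)%R ->
  ex_series (theta_weight K q).
Proof.
  intros HK hq.
  assert (Hp : forall n, (0 < theta_weight K q n)%R).
  { induction n as [|n IH]; simpl; [lra|].
    pose proof (pow_lt q n (proj1 hq)). apply Rmult_lt_0_compat; nra. }
  apply ex_series_Rabs, (ex_series_DAlembert _ 0); [lra| |].
  - intros n. specialize (Hp n). lra.
  - apply (is_lim_seq_ext (fun n => (K * q ^ n)%R)).
    + intros n. pose proof (Hp n). pose proof (pow_lt q n (proj1 hq)). simpl.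
      replace (theta_weight K q n * (K * q ^ n) / theta_weight K q n)%R
        with (K * q ^ n)%R by (field; lra).
      rewrite Rabs_pos_eq; nra.
    + replace (Finite 0) with (Rbar_mult K 0%R) by (simpl; f_equal; ring).
      apply is_lim_seq_scal_l, is_lim_seq_geom. rewrite Rabs_pos_eq; lra.
Qed.

Lemma quad_alpha_summable (q : R) (alpha lam : C) :
  (0 < q < 1)%R -> lam <> 0 -> 1 - alpha <> 0 ->
  (forall k, 1 - lam * q ^ k <> 0) ->
  ex_series (fun J => Cmod (if Nat.even J then quad_alpha q alpha lam (Nat.div2 J) else 0)).
Proof.
  intros hq Hl0 Ha Hl.
  (* The summand 1 gives K <= K^2, so K^2 bounds |lam| + |q alpha|; it also makes K positive when
     the moduli vanish. *)
  set (K := (1 + Cmod lam + Cmod (q * alpha))%R).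
  pose proof (Cmod_ge_0 lam). pose proof (Cmod_ge_0 (q * alpha)).
  assert (hq2 : (0 < q ^ 2 < 1)%R) by nra.
  assert (Eq2 : RtoC (q ^ 2) = q ^ 2) by apply RtoC_pow.
  assert (Hb : bdd (fun j => (1 - alpha * q ^ (4 * j)) * (/ (1 - alpha) * (qpoch alpha (q ^ 2) j
      * (/ qpoch (q ^ 2) (q ^ 2) j * / qpoch (q * lam) (q ^ 2) j))))).
  { rewrite <- Eq2. repeat apply bdd_mult; auto using bdd_qpoch, bdd_const.
    - exists (1 + Cmod alpha)%R. intros j. eapply Rle_trans; [apply Cmod_triangle|].
      rewrite Cmod_opp, Cmod_mult, Cmod_q_pow, Cmod_1 by assumption.
      pose proof (pow_q_bounds q hq (4 * j)). pose proof (Cmod_ge_0 alpha). nra.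
    - apply bdd_inv_qpoch; [assumption|]. intros k.
      apply one_minus_q_nz; assumption.
    - apply bdd_inv_qpoch; [assumption|]. intros k. rewrite Eq2.
      replace (q * lam * (q ^ 2) ^ k) with (lam * q ^ (S (2 * k))); [apply Hl|].
      rewrite Cpow_S, Cpow_mult_r. ring. }
  destruct (bdd_pos _ Hb) as [B [B0 HB]].
  (* Pairing each [lam] with one factor of the symbol gives the product of the lam - q alpha q^(2k),
     which has no [lam] in a denominator. *)
  assert (HL : forall j, (Cmod (qpoch (q * alpha / lam) (q ^ 2) j * lam ^ j) <= (K ^ 2) ^ j)%R).
  { induction j as [|j IH]; [simpl; rewrite Cmod_mult, Cmod_1; lra|].
    rewrite qpoch_S, (Cpow_S lam).
    replace (qpoch (q * alpha / lam) (q ^ 2) j * (1 - q * alpha / lam * (q ^ 2) ^ j) *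
      (lam * lam ^ j)) with ((qpoch (q * alpha / lam) (q ^ 2) j * lam ^ j)
      * (lam - q * alpha * (q ^ 2) ^ j)) by (field; assumption).
    rewrite Cmod_mult. simpl ((K ^ 2) ^ S j)%R. rewrite Rmult_comm.
    apply Rmult_le_compat; auto using Cmod_ge_0.
    eapply Rle_trans; [apply Cmod_triangle|].
    rewrite Cmod_opp, (Cmod_mult (q * alpha)), <- Eq2, Cmod_q_pow by assumption.
    pose proof (pow_q_bounds _ hq2 j). unfold K. nra. }
  destruct (ex_series_theta_weight K q ltac:(unfold K; lra) hq) as [s Hs].
  apply (ex_series_le (V := R_CompleteNormedModule) _ (fun J => (B * theta_weight K q J)%R)).
  2: exact (ex_series_scal_l B _ (ex_intro _ s Hs)).
  intros J. change (norm ?x) with (Rabs x). rewrite Rabs_pos_eq by apply Cmod_ge_0.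
  destruct (Nat.even J) eqn:Ev.
  - apply Nat.even_spec in Ev as [j ->]. rewrite Nat.div2_double, theta_weight_double.
    unfold quad_alpha.
    match goal with |- (Cmod ?z <= _)%R => replace z with
      (((1 - alpha * q ^ (4 * j)) * (/ (1 - alpha) * (qpoch alpha (q ^ 2) j
      * (/ qpoch (q ^ 2) (q ^ 2) j * / qpoch (q * lam) (q ^ 2) j)))) *
      ((qpoch (q * alpha / lam) (q ^ 2) j * lam ^ j) * q ^ (2 * j ^ 2 - j))) end.
    + rewrite Cmod_mult, (Cmod_mult (_ * lam ^ j)), Cmod_q_pow by assumption.
      pose proof (pow_q_bounds q hq (2 * j ^ 2 - j)).
      repeat (apply Rmult_le_compat || apply Rmult_le_pos || apply Cmod_ge_0); auto; lra.
    + field. repeat split; auto.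
      * apply qpoch_nz. intros k.
        replace (q * lam * (q ^ 2) ^ k) with (lam * q ^ (S (2 * k))); [apply Hl|].
        rewrite Cpow_S, Cpow_mult_r. ring.
      * rewrite <- Eq2. apply qpoch_nz, one_minus_q_nz, hq2.
  - rewrite Cmod_0. apply Rmult_le_pos; [assumption|].
    clear Ev Hs. induction J as [|J IH]; simpl; [lra|].
    pose proof (pow_q_bounds q hq J). apply Rmult_le_pos; [assumption|].
    apply Rmult_le_pos; unfold K; lra.
Qed.

(** * Convergence of the inner series and assembly of the identity *)

Lemma phi32_ex (q : R) (a1 a2 a3 b1 b2 z : C) :
  (0 < q < 1)%R -> (Cmod z < 1)%R ->
  (forall k, 1 - b1 * q ^ k <> 0) -> (forall k, 1 - b2 * q ^ k <> 0) ->
  ex_Cseries (phi32_term a1 a2 a3 b1 b2 q z).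
Proof.
  intros hq hz H1 H2.
  pose proof (one_minus_q_nz q hq) as Hq.
  assert (Hb : bdd (fun m => qpoch a1 q m * (qpoch a2 q m * qpoch a3 q m)
    * (/ qpoch q q m * (/ qpoch b1 q m * / qpoch b2 q m)))).
  { repeat apply bdd_mult; auto using bdd_qpoch, bdd_inv_qpoch. }
  destruct (bdd_pos _ Hb) as [B [B0 HB]].
  apply (ex_Cseries_le _ (fun m => (B * Cmod z ^ m)%R)).
  - intros m. unfold phi32_term, qpochs. simpl.
    match goal with |- (Cmod ?w <= _)%R => replace w with
      (qpoch a1 q m * (qpoch a2 q m * qpoch a3 q m)
       * (/ qpoch q q m * (/ qpoch b1 q m * / qpoch b2 q m)) * z ^ m) end.
    + rewrite Cmod_mult, Cmod_pow. apply Rmult_le_compat_r; auto.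
      apply pow_le, Cmod_ge_0.
    + field. repeat split; now apply qpoch_nz.
  - exact (ex_series_scal_l B _ (ex_series_geom_C z hz)).
Qed.

Lemma phi32_correct (q : R) (a1 a2 a3 b1 b2 z : C) :
  ex_Cseries (phi32_term a1 a2 a3 b1 b2 q z) ->
  Cis_series (phi32_term a1 a2 a3 b1 b2 q z) (phi32 a1 a2 a3 b1 b2 q z).
Proof. intros [l Hl]. unfold phi32. now rewrite (CSeries_correct _ _ Hl). Qed.

Lemma Cmod_mult_lt_1 (x y : C) : (Cmod x < 1)%R -> (Cmod y < 1)%R -> (Cmod (x * y) < 1)%R.
Proof.
  intros. rewrite Cmod_mult. pose proof (Cmod_ge_0 x). pose proof (Cmod_ge_0 y). nra.
Qed.

Theorem theorem6p8 (q : R) (a b c d r lam alpha sqlam sqqalpha : C)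
  (hq : (0 < q < 1)%R)
  (ha : (Cmod a < 1)%R) (hb : (Cmod b < 1)%R) (hc : (Cmod c < 1)%R)
  (hd : (Cmod d < 1)%R) (hr : (Cmod r < 1)%R)
  (halpha : alpha = a ^ 2 * b * c * d * r / q)
  (hsqlam : sqlam ^ 2 = lam)
  (hsqqalpha : sqqalpha ^ 2 = q * alpha)
  (* the denominators that the bounds above do not already make nonzero *)
  (hlam0 : lam <> 0)
  (hlam : forall k : nat, lam * q ^ k <> 1)
  (halpha1 : alpha <> 1) :
  let lhs_inner (n : nat) : nat -> C :=
    phi32_term (a * b * q ^ n) (a * c * q ^ n) (b * c)
               (a * b * c * d * q ^ n) (a * b * c * r * q ^ n) q (d * r) in
  let lhs_term (n : nat) : C :=
    qpochs [sqlam; - sqlam; a * b; a * c; a * d; a * r] q n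
      * (b * c * d * r) ^ n
    / qpochs [RtoC q; sqqalpha; - sqqalpha; lam; a * b * c * d; a * b * c * r]
        q n
    * phi32 (a * b * q ^ n) (a * c * q ^ n) (b * c)
            (a * b * c * d * q ^ n) (a * b * c * r * q ^ n) q (d * r) in
  let rhs_term (n : nat) : C :=
    (1 - alpha * q ^ (4 * n))
      * qpochs [alpha; a * b; a * c; a * d; a * r] q (2 * n)
      * qpochs [RtoC q; q * alpha / lam] (q ^ 2) n
    / ((1 - alpha)
      * qpochs [RtoC q; a * b * c * d; a * b * c * r; a * b * d * r;
                a * c * d * r] q (2 * n)
      * qpochs [q * alpha; q * lam] (q ^ 2) n)
    * (b * c * d * r) ^ (2 * n) * lam ^ n * q ^ (2 * n ^ 2 - n) in
  (forall n : nat, ex_Cseries (lhs_inner n)) /\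
  ex_Cseries lhs_term /\
  ex_Cseries rhs_term /\
  CSeries lhs_term
  = qpochs_inf [a * b * d * r; a * c * d * r] q
    / qpochs_inf [d * r; q * alpha] q
    * CSeries rhs_term.
Proof.
  intros lhs_inner lhs_term rhs_term.
  pose proof (one_minus_q_nz q hq) as Hq.
  assert (Hq0 : RtoC q <> 0) by (intros Z; apply RtoC_inj in Z; lra).
  assert (Ha1 : 1 - alpha <> 0).
  { intros Z. apply halpha1. replace alpha with (1 - (1 - alpha)) by ring. rewrite Z. ring. }
  assert (Hl : forall k, 1 - lam * q ^ k <> 0).
  { intros k Z. apply (hlam k). replace (lam * q ^ k) with (1 - (1 - lam * q ^ k)) by ring.
    rewrite Z. ring. }
  set (e := q * alpha).
  (* These are the two factorizations e = XYt, for the finite and the infinite Bailey step. *)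
  assert (Ee1 : e = a * d * (a * r) * (b * c)) by (unfold e; rewrite halpha; field; assumption).
  assert (Ee2 : e = a * b * (a * c) * (d * r)) by (rewrite Ee1; ring).
  assert (Mdr : (Cmod (d * r) < 1)%R) by now apply Cmod_mult_lt_1.
  assert (Mbc : (Cmod (b * c) < 1)%R) by now apply Cmod_mult_lt_1.
  assert (He : forall k, 1 - e * q ^ k <> 0).
  { intros k. apply one_minus_nz; [assumption|]. rewrite Ee1. auto using Cmod_mult_lt_1. }
  assert (H1 : forall k, 1 - a * b * c * d * q ^ k <> 0)
    by (intros k; apply one_minus_nz; auto using Cmod_mult_lt_1).
  assert (H2 : forall k, 1 - a * b * c * r * q ^ k <> 0)
    by (intros k; apply one_minus_nz; auto using Cmod_mult_lt_1).
  assert (H3 : forall k, 1 - a * b * d * r * q ^ k <> 0)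
    by (intros k; apply one_minus_nz; auto using Cmod_mult_lt_1).
  assert (H4 : forall k, 1 - a * c * d * r * q ^ k <> 0)
    by (intros k; apply one_minus_nz; auto using Cmod_mult_lt_1).
  assert (E1 : a * d * (b * c) = a * b * c * d) by ring.
  assert (E2 : a * r * (b * c) = a * b * c * r) by ring.
  assert (E3 : a * b * (d * r) = a * b * d * r) by ring.
  assert (E4 : a * c * (d * r) = a * c * d * r) by ring.
  assert (Eq2 : RtoC (q ^ 2) = q ^ 2) by apply RtoC_pow.
  assert (hq2 : (0 < q ^ 2 < 1)%R) by nra.
  assert (He2 : forall k, 1 - e * (q ^ 2) ^ k <> 0).
  { intros k. rewrite <- Cpow_mult_r. apply He. }
  assert (Nq : forall k, qpoch q q k <> 0) by (intros; now apply qpoch_nz).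
  assert (Nl : forall k, qpoch lam q k <> 0) by (intros; now apply qpoch_nz).
  assert (Ne2 : forall k, qpoch e (q ^ 2) k <> 0) by (intros; now apply qpoch_nz).
  assert (N1 : forall k, qpoch (a * b * c * d) q k <> 0) by (intros; now apply qpoch_nz).
  assert (N2 : forall k, qpoch (a * b * c * r) q k <> 0) by (intros; now apply qpoch_nz).
  assert (N3 : forall k, qpoch (a * b * d * r) q k <> 0) by (intros; now apply qpoch_nz).
  assert (N4 : forall k, qpoch (a * c * d * r) q k <> 0) by (intros; now apply qpoch_nz).
  assert (Hsh : forall x n, (forall k, 1 - x * q ^ k <> 0) ->
     forall k, 1 - x * q ^ n * q ^ k <> 0).
  { intros x n Hx k. rewrite <- Cmult_assoc, <- Cpow_add_r. apply Hx. }
  assert (Hin : forall n, ex_Cseries (lhs_inner n)).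
  { intros n. apply phi32_ex; auto. }
  pose proof (quad_bailey_pair q alpha lam Hq0 hlam0 Ha1 Hq Hl He) as P0. fold e in P0.
  set (w := fun n => qpoch lam (q ^ 2) n
      / (qpoch q q n * qpoch lam q n * qpoch e (q ^ 2) n)) in P0.
  set (al0 := fun J => if Nat.even J then quad_alpha q alpha lam (Nat.div2 J) else 0) in P0.
  assert (P1 := P0).
  apply (bailey_finite q e (a * d) (a * r) (b * c)) in P1; trivial;
    [|rewrite E1; assumption | rewrite E2; assumption].
  rewrite E1, E2 in P1.
  set (al1 := fun J : nat => _) in P1. set (be1 := fun M : nat => _) in P1.
  assert (Sal : ex_series (fun J => Cmod (al1 J))).
  { assert (Hb : bdd (fun J => qpoch (a * d) q J * qpoch (a * r) q J * (b * c) ^ J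
      * (/ qpoch (a * b * c * d) q J * / qpoch (a * b * c * r) q J))).
    { repeat apply bdd_mult; auto using bdd_qpoch, bdd_inv_qpoch.
      apply bdd_geom. lra. }
    destruct (bdd_pos _ Hb) as [B [B0 HB]].
    apply (ex_series_le (V := R_CompleteNormedModule) _ (fun J => (B * Cmod (al0 J))%R)).
    2: exact (ex_series_scal_l B _ (quad_alpha_summable q alpha lam hq hlam0 Ha1 Hl)).
    intros J. change (norm ?x) with (Rabs x). rewrite Rabs_pos_eq by apply Cmod_ge_0.
    unfold al1. rewrite Cmod_mult. apply Rmult_le_compat_r; [apply Cmod_ge_0|].
    eapply Rle_trans; [|apply (HB J)]. right. f_equal. field. auto. }
  destruct (bailey_infinite q e (a * b) (a * c) (d * r) al1 be1) as [S [S1 S2]]; trivial;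
    [rewrite E3; assumption | rewrite E4; assumption |].
  rewrite E3, E4 in S1, S2.
  assert (R1 : Cis_series rhs_term S).
  { assert (Hphi : forall N, (N <= Datatypes.S (2 * N))%nat) by (intros; lia).
    apply clim_ext with (2 := clim_subseq _ _ _ Hphi S1).
    intros N. refine (eq_trans _ (csum_even rhs_term N)).
    apply csum_ext. intros J _. unfold al1, al0.
    destruct (Nat.even J) eqn:Ev; [|ring].
    apply Nat.even_spec in Ev as [j ->]. rewrite Nat.div2_double.
    unfold rhs_term, qpochs, quad_alpha. cbn [fold_right]. fold e.
    assert (Nqq : qpoch (q ^ 2) (q ^ 2) j <> 0).
    { rewrite <- Eq2. apply qpoch_nz, one_minus_q_nz, hq2. }
    assert (Nqo : qpoch q (q ^ 2) j <> 0).
    { apply qpoch_nz. intros k. rewrite <- Cpow_mult_r. apply Hq. }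
    assert (Nql : qpoch (q * lam) (q ^ 2) j <> 0).
    { apply qpoch_nz. intros k.
      replace (q * lam * (q ^ 2) ^ k) with (lam * q ^ (Datatypes.S (2 * k))); [apply Hl|].
      rewrite Cpow_S, Cpow_mult_r. ring. }
    replace (b * c * d * r) with (b * c * (d * r)) by ring.
    rewrite (Cpow_mult_l (b * c)), (qpoch_double alpha), (qpoch_double q).
    replace (alpha * q) with e by (unfold e; ring).
    replace (RtoC q * RtoC q) with (RtoC q ^ 2) by ring.
    field. repeat split; auto. }
  assert (L1 : Cis_series lhs_term (qpoch_inf (a * b * d * r) q * qpoch_inf (a * c * d * r) q
       / (qpoch_inf (d * r) q * qpoch_inf e q) * S)).
  { pose (g n m := qpoch (a * b) q (n + m) * qpoch (a * c) q (n + m)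
        / (qpoch (a * b * c * d) q (n + m) * qpoch (a * b * c * r) q (n + m))
      * (qpoch (a * d) q n * qpoch (a * r) q n * w n * (b * c * (d * r)) ^ n)
      * (qpoch (b * c) q m / qpoch q q m * (d * r) ^ m)).
    pose (pre n := qpochs [sqlam; - sqlam; a * b; a * c; a * d; a * r] q n
      * (b * c * d * r) ^ n
      / qpochs [RtoC q; sqqalpha; - sqqalpha; lam; a * b * c * d; a * b * c * r] q n).
    assert (Hg : forall n, Cis_series (g n) (lhs_term n)).
    { intros n.
      pose proof (Cis_series_scal (pre n) _ _ (phi32_correct _ _ _ _ _ _ _ (Hin n))) as G.
      apply Cis_series_ext with (2 := G). intros m.
      unfold pre, phi32_term, qpochs, g, w. cbn [fold_right].
      (* Each pair of opposite square roots collapses to one symbol in base q^2, the form used in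
         [w]. *)
      rewrite (Cmult_assoc (qpoch sqlam q n)), (qpoch_opp_sqrt sqlam), hsqlam.
      rewrite (Cmult_assoc (qpoch sqqalpha q n)), (qpoch_opp_sqrt sqqalpha), hsqqalpha.
      fold e.
      pose proof (N1 (n + m)%nat) as N1'. pose proof (N2 (n + m)%nat) as N2'.
      rewrite !qpoch_add in *.
      replace (b * c * d * r) with (b * c * (d * r)) by ring.
      field. repeat split; auto;
      intros Z; solve [apply N1'; rewrite Z; ring | apply N2'; rewrite Z; ring]. }
    (* The only factor coupling n and m is uniformly bounded, so [g n m] has a majorant that is a
       product of two geometric sequences. *)
    assert (Hb1 : bdd (fun k => qpoch (a * b) q k * qpoch (a * c) q k
        * (/ qpoch (a * b * c * d) q k * / qpoch (a * b * c * r) q k)))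
      by (repeat apply bdd_mult; auto using bdd_qpoch, bdd_inv_qpoch).
    assert (Hb2 : bdd (fun n => qpoch (a * d) q n * qpoch (a * r) q n *
       (qpoch lam (q ^ 2) n * (/ qpoch q q n * / qpoch lam q n * / qpoch e (q ^ 2) n)))).
    { rewrite <- Eq2. repeat apply bdd_mult; auto using bdd_qpoch, bdd_inv_qpoch.
      apply bdd_inv_qpoch; [assumption|]. rewrite Eq2. exact He2. }
    assert (Hb3 : bdd (fun m => qpoch (b * c) q m * / qpoch q q m))
      by (apply bdd_mult; auto using bdd_qpoch, bdd_inv_qpoch).
    destruct (bdd_pos _ Hb1) as [B1 [P1' HB1]].
    destruct (bdd_pos _ Hb2) as [B2 [P2' HB2]].
    destruct (bdd_pos _ Hb3) as [B3 [P3' HB3]].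
    destruct (series_triangle g lhs_term (fun n => (B1 * B2 * Cmod (b * c * (d * r)) ^ n)%R)
      (fun m => (B3 * Cmod (d * r) ^ m)%R)) as [S' [T1 T2]].
    - intros n. repeat apply Rmult_le_pos; trivial. apply pow_le, Cmod_ge_0.
    - intros n. repeat apply Rmult_le_pos; trivial. apply pow_le, Cmod_ge_0.
    - intros n m.
      replace (g n m) with ((qpoch (a * b) q (n + m) * qpoch (a * c) q (n + m)
        * (/ qpoch (a * b * c * d) q (n + m) * / qpoch (a * b * c * r) q (n + m)))
        * (qpoch (a * d) q n * qpoch (a * r) q n *
       (qpoch lam (q ^ 2) n * (/ qpoch q q n * / qpoch lam q n * / qpoch e (q ^ 2) n)))
        * (b * c * (d * r)) ^ n
        * ((qpoch (b * c) q m * / qpoch q q m) * (d * r) ^ m)).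
      2: { unfold g, w. field. repeat split; auto. }
      rewrite Cmod_mult. rewrite (Cmod_mult _ ((d * r) ^ m)).
      rewrite (Cmod_mult _ ((b * c * (d * r)) ^ n)).
      rewrite (Cmod_mult (_ * (/ qpoch (a * b * c * d) q _ * _))).
      rewrite !Cmod_pow.
      pose proof (pow_le _ n (Cmod_ge_0 (b * c * (d * r)))).
      pose proof (pow_le _ m (Cmod_ge_0 (d * r))).
      repeat (apply Rmult_le_compat || apply Rmult_le_pos || apply Cmod_ge_0); auto; try apply Rle_refl.
    - apply (ex_series_scal_l _ (fun n => (Cmod (b * c * (d * r)) ^ n)%R)), ex_series_geom_C.
      now apply Cmod_mult_lt_1.
    - exact (ex_series_scal_l B3 _ (ex_series_geom_C _ Mdr)).
    - exact Hg.
    - replace (qpoch_inf (a * b * d * r) q * qpoch_inf (a * c * d * r) q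
       / (qpoch_inf (d * r) q * qpoch_inf e q) * S) with S'; [exact T1|].
      apply (clim_unique _ _ _ T2).
      apply (Cis_series_ext) with (2 := S2). intros M. unfold be1.
      rewrite Cmult_assoc, <- csum_mult_l. apply csum_ext. intros n Hn. unfold g.
      replace (n + (M - n))%nat with M by lia.
      replace ((d * r) ^ M) with ((d * r) ^ n * (d * r) ^ (M - n))
        by (rewrite <- Cpow_add_r; f_equal; lia).
      rewrite !Cpow_mult_l. field. repeat split; auto. }
  split; [exact Hin|].
  split; [now exists (qpoch_inf (a * b * d * r) q * qpoch_inf (a * c * d * r) q
       / (qpoch_inf (d * r) q * qpoch_inf e q) * S)|].
  split; [now exists S|].
  rewrite (CSeries_correct _ _ L1), (CSeries_correct _ _ R1).
  unfold qpochs_inf. simpl. fold e. rewrite !Cmult_1_r. reflexivity.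
Qed.
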